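(* Let $n\geq 3$ and let $q$ be a prime power. Then $\Delta_0^{+}(\mathrm{Fl}_{n,q})$ is a $|\mathrm{Fl}_{n,q}(0)|\times|\mathrm{Fl}_{n,q}(0)|$ matrix with entries $$\Delta_0^{+}(\mathrm{Fl}_{n,q})_{U,V}=\begin{cases} n-2 & \text{if } U=V,\\ - \binom{n-\dim(U)}{\dim(V)-\dim(U)}_q^{-1} & \text{if } U\subsetneq V,\\ - \binom{\dim(U)}{\dim(V)}_q^{-1} & \text{if } V\subsetneq U,\\ 0 & \text{otherwise,}\end{cases}$$ for every two non-trivial subspaces $U,V\subset \mathbb{F}_q^n$.
   Context: A linear subspace of $\mathbb{F}_q^n$ is non-trivial if it is neither $\{0\}$ nor $\mathbb{F}_q^n$. A flag is a family of nested non-trivial subspaces $V_1\subsetneq\cdots\subsetneq V_k$; a complete flag is a flag of length $n-1$. $\mathrm{Fl}_{n,q}$ is the simplicial complex whose vertices are the non-trivial subspaces of $\mathbb{F}_q^n$ and whose simplices are the families of subspaces forming a flag; $\mathrm{Fl}_{n,q}(0)$ is its set of vertices. For a simplex $\sigma$, $w(\sigma)$ is the number of complete flags containing $\sigma$. $C^0(\mathrm{Fl}_{n,q})$ is the space of real functions on the vertices, and $C^1(\mathrm{Fl}_{n,q})$ the space of real skew-symmetric functions on ordered $1$-simplices. The coboundary operator $d_0:C^0\to C^1$ is $(d_0\phi)([U,V])=\phi(V)-\phi(U)$. For $k=0,1$ the space $C^k$ carries the inner product $\langle\phi,\psi\rangle=\sum_{\sigma} w(\sigma)\phi(\sigma)\psi(\sigma)$,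 summed over $k$-simplices $\sigma$ (each given one fixed order). $d_0^*$ is the adjoint of $d_0$, and $\Delta_0^{+}(\mathrm{Fl}_{n,q})=d_0^*d_0$, identified with its matrix in the standard basis of indicator functions $1_U$ of vertices; the $(U,V)$ entry is in row $1_U$, column $1_V$. $\binom{a}{b}_q$ denotes the number of $b$-dimensional subspaces of $\mathbb{F}_q^a$. *)

(* Defs.v *)
From HB Require Import structures.
From mathcomp Require Import all_boot all_order all_algebra.
From mathcomp Require Import boolp reals.
From mathcomp Require classical_sets.

Set Implicit Arguments.
Unset Strict Implicit.
Unset Printing Implicit Defensive.

Import GRing.Theory.

Local Open Scope ring_scope.

Module VspaceFinite.
Import VectorInternalTheory.

#[export] HB.instance Definition _ (F : finFieldType) (vT : vectType F) :=
  [Countable of {vspace vT} by <:].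
#[export] HB.instance Definition _ (F : finFieldType) (vT : vectType F) :=
  [Finite of {vspace vT} by <:].

Module Exports. HB.reexport. End Exports.
End VspaceFinite.
Export VspaceFinite.Exports.

Definition prime_power (q : nat) : Prop :=
  exists p k : nat, [/\ prime p, (0 < k)%N & q = (p ^ k)%N].

Definition gauss_binom (F : finFieldType) (a b : nat) : nat :=
  #|[set W : {vspace 'rV[F]_a} | \dim W == b]|.

Definition psubv (F : finFieldType) (vT : vectType F) : rel {vspace vT} :=
  fun U V => (U <= V)%VS && (U != V).

Definition nontrivial (F : finFieldType) (n : nat) (U : {vspace 'rV[F]_n}) :
  bool := (U != 0%VS) && (U != fullv).

Definition vertex (F : finFieldType) (n : nat) : finType :=
  {U : {vspace 'rV[F]_n} | nontrivial U}.

Definition flag (F : finFieldType) (n : nat) (c : seq (vertex F n)) : bool :=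
  sorted (fun U V => psubv (val U) (val V)) c.

Definition simplex (F : finFieldType) (n : nat) (s : {set vertex F n}) : bool :=
  [exists c : #|s|.-tuple (vertex F n), flag c && (s == [set U in c])].

Definition complete_flag (F : finFieldType) (n : nat) (s : {set vertex F n}) :
  bool := simplex s && (#|s| == n.-1).

Definition weight (F : finFieldType) (n : nat) (s : {set vertex F n}) : nat :=
  #|[set t : {set vertex F n} | complete_flag t && (s \subset t)]|.

Definition is_edge (F : finFieldType) (n : nat) (e : vertex F n * vertex F n) :
  bool := (e.1 != e.2) && simplex [set e.1; e.2].

(* Ordered 1-simplices: every 1-simplex occurs twice, once in each order. *)
Definition edge (F : finFieldType) (n : nat) : finType :=
  {e : vertex F n * vertex F n | is_edge e}.

Definition source (F : finFieldType) (n : nat) (e : edge F n) : vertex F n :=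
  (val e).1.

Definition target (F : finFieldType) (n : nat) (e : edge F n) : vertex F n :=
  (val e).2.

Lemma is_edge_rev (F : finFieldType) (n : nat) (e : edge F n) :
  is_edge (target e, source e).
Proof. by rewrite /is_edge /= eq_sym setUC; exact: (valP e). Qed.

Definition rev_edge (F : finFieldType) (n : nat) (e : edge F n) : edge F n :=
  Sub (target e, source e) (is_edge_rev e).

(* R^o is R seen as a module over itself; this makes C0 and C1 R-modules. *)
Definition C0 (R : realType) (F : finFieldType) (n : nat) : lmodType R :=
  {ffun vertex F n -> R^o}.

Definition skew (R : realType) (F : finFieldType) (n : nat) :
  {pred {ffun edge F n -> R^o}} :=
  fun psi => [forall e, psi (rev_edge e) == - psi e].

Lemma skew_submod_closed (R : realType) (F : finFieldType) (n : nat) :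
  submod_closed (@skew R F n).
Proof.
split=> [|a f g /forallP fP /forallP gP]; apply/forallP => e.
  by rewrite !ffunE oppr0.
by rewrite !ffunE (eqP (fP e)) (eqP (gP e)) scalerN opprD.
Qed.

HB.instance Definition _ (R : realType) (F : finFieldType) (n : nat) :=
  GRing.isSubmodClosed.Build R {ffun edge F n -> R^o} (@skew R F n)
    (@skew_submod_closed R F n).

Record C1 (R : realType) (F : finFieldType) (n : nat) : Type := MkC1 {
  C1val : {ffun edge F n -> R^o};
  C1valP : C1val \in @skew R F n
}.

HB.instance Definition _ (R : realType) (F : finFieldType) (n : nat) :=
  [isSub for @C1val R F n].
HB.instance Definition _ (R : realType) (F : finFieldType) (n : nat) :=
  [Choice of C1 R F n by <:].
HB.instance Definition _ (R : realType) (F : finFieldType) (n : nat) :=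
  [SubChoice_isSubLmodule of C1 R F n by <:].

Definition ip0 (R : realType) (F : finFieldType) (n : nat) (phi psi : C0 R F n) :
  R := \sum_(U : vertex F n) (weight [set U])%:R * phi U * psi U.

(* Each 1-simplex {U, V} is given the order [U, V] with U properly contained
   in V. *)
Definition ip1 (R : realType) (F : finFieldType) (n : nat) (phi psi : C1 R F n) :
  R :=
  \sum_(e : edge F n | psubv (val (source e)) (val (target e)))
    (weight [set source e; target e])%:R * C1val phi e * C1val psi e.

Definition d0_fun (R : realType) (F : finFieldType) (n : nat) (phi : C0 R F n) :
  {ffun edge F n -> R^o} := [ffun e => phi (target e) - phi (source e)].

Lemma d0_skew (R : realType) (F : finFieldType) (n : nat) (phi : C0 R F n) :
  d0_fun phi \in @skew R F n.
Proof. by apply/forallP => e; rewrite !ffunE opprB. Qed.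

Definition d0 (R : realType) (F : finFieldType) (n : nat) (phi : C0 R F n) :
  C1 R F n := MkC1 (d0_skew phi).

Definition is_adjoint (R : realType) (F : finFieldType) (n : nat)
  (d : C0 R F n -> C1 R F n) (g : C1 R F n -> C0 R F n) : Prop :=
  forall phi psi, ip1 (d phi) psi = ip0 phi (g psi).

(* [classical_sets.xget x P] is an element of P when P is nonempty, and x otherwise. *)
Definition d0_adj (R : realType) (F : finFieldType) (n : nat) :
  C1 R F n -> C0 R F n :=
  classical_sets.xget (fun=> 0) (fun g => is_adjoint (@d0 R F n) g).

Definition laplacian (R : realType) (F : finFieldType) (n : nat)
  (phi : C0 R F n) : C0 R F n := d0_adj (d0 phi).

Definition indic (R : realType) (F : finFieldType) (n : nat) (U : vertex F n) :
  C0 R F n := [ffun W => (W == U)%:R].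

(* Column j holds the coordinates of the image of the j-th indicator function;
   the coordinate of a function on the indicator of a vertex is its value
   there. *)
Definition laplacian_mx (R : realType) (F : finFieldType) (n : nat) :
  'M[R]_#|vertex F n| :=
  \matrix_(i, j) laplacian (indic R (enum_val j)) (enum_val i).

(* Main.v *)
Require Import Defs.
From mathcomp Require Import all_boot all_order all_algebra.
From mathcomp Require Import reals.
From mathcomp Require classical_sets.

(** Since <1_U, Delta phi> = <d 1_U, d phi> and <1_U, psi> = w(U) psi(U), the
    up-Laplacian acts as a weighted graph Laplacian,
      (Delta phi)(U) =
        w(U)^-1 * sum_(V incident to U) w({U, V}) (phi(U) - phi(V)),
    as soon as every w(U) is nonzero ([weight_gt0], [laplacianE]).  The matrix
    entries are therefore read off from two facts about complete flags.

    On the diagonal, the sum of w({U, V}) over V <> U counts each complete flag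
    through U once for every other member, that is n - 2 times
    ([sum_weight_neq]).

    Off the diagonal, the ratio w({U, V}) / w(U) is needed.  A complete flag has
    exactly one member of each dimension k with 0 < k < n, so w(U) is the sum of
    w({U, V}) over the V of dimension k ([sum_weight_dim]); for k <> dim U only
    the V incident to U contribute.  All these V give the same w({U, V}),
    because the linear group is transitive on nested pairs of subspaces of given
    dimensions ([aut_of_flag], [weight_pair_dim]).  Hence w(U) is w({U, V})
    times the number of such V, and this number is a Gaussian binomial:
    subspaces of U correspond to subspaces of F^(dim U), and subspaces
    containing U to subspaces of the quotient F^(n - dim U) ([card_subspaces],
    [card_superspaces], [weight_above], [weight_below]). *)

Set Implicit Arguments.
Unset Strict Implicit.
Unset Printing Implicit Defensive.

Import GRing.Theory Num.Theory.
Local Open Scope ring_scope.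

(** * Linear maps adapted to subspaces *)

Lemma lfun_of_free (K : fieldType) (aT rT : vectType K) (X : seq aT)
    (Y : seq rT) :
  free X -> size Y = size X -> exists f : 'Hom(aT, rT), map f X = Y.
Proof.
move=> frX szY; have [f fP] := linear_of_free X Y.
exists (linfun f); rewrite -[RHS](fP frX szY).
by apply: eq_map => x; rewrite lfunE.
Qed.

Lemma basis_compl (K : fieldType) (vT : vectType K) (U : {vspace vT}) :
  basis_of fullv (vbasis U ++ vbasis U^C%VS).
Proof.
rewrite -(addv_complf U); apply: cat_basis; try exact: vbasisP.
by apply/directv_addP; rewrite capv_compl.
Qed.

Lemma adapted_basis (K : fieldType) (vT : vectType K) (U V : {vspace vT}) :
  (U <= V)%VS -> exists X Y Z : seq vT,
    [/\ <<X>>%VS = U, <<X ++ Y>>%VS = V & basis_of fullv (X ++ Y ++ Z)].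
Proof.
move=> sUV; exists (vbasis U), (vbasis (V :\: U)%VS), (vbasis V^C%VS).
have defV : (U + (V :\: U))%VS = V by rewrite addvC addv_diff; apply/addv_idPl.
have bV : basis_of V (vbasis U ++ vbasis (V :\: U)%VS).
  rewrite -{1}defV; apply: cat_basis; try exact: vbasisP.
  by apply/directv_addP; rewrite capvC capv_diff.
split; first exact: span_basis (vbasisP U); first exact: span_basis bV.
rewrite catA -(addv_complf V); apply: cat_basis (bV) (vbasisP _).
by apply/directv_addP; rewrite capv_compl.
Qed.

Lemma lker0_dim (K : fieldType) (aT rT : vectType K) (f : 'Hom(aT, rT))
    (U : {vspace aT}) : lker f == 0%VS -> \dim (f @: U) = \dim U.
Proof. by move/eqP=> kf; apply: limg_dim_eq; rewrite kf capv0. Qed.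

(** Transitivity of the linear group on pairs of nested subspaces: map a basis
    adapted to the first pair onto one adapted to the second. *)
Lemma aut_of_flag (K : fieldType) (vT : vectType K)
    (U1 V1 U2 V2 : {vspace vT}) :
  (U1 <= V1)%VS -> (U2 <= V2)%VS -> \dim U1 = \dim U2 -> \dim V1 = \dim V2 ->
  exists f : 'End(vT),
    [/\ lker f == 0%VS, (f @: U1)%VS = U2 & (f @: V1)%VS = V2].
Proof.
move=> s1 s2 dU dV.
have [X1 [Y1 [Z1 [spU1 spV1 b1]]]] := adapted_basis s1.
have [X2 [Y2 [Z2 [spU2 spV2 b2]]]] := adapted_basis s2.
have [fr1 fr2] := (basis_free b1, basis_free b2).
have fX1 := catl_free fr1; have fX2 := catl_free fr2.
move: (fr1) (fr2); rewrite !catA => /catl_free fV1 /catl_free fV2.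
have szX : size X2 = size X1.
  by rewrite -(eqP fX1) -(eqP fX2) spU1 spU2.
(* The two lists have blocks of equal sizes, so the map matches them blockwise. *)
have szV : size (X2 ++ Y2) = size (X1 ++ Y1).
  by rewrite -(eqP fV1) -(eqP fV2) spV1 spV2.
have sz : size (X2 ++ Y2 ++ Z2) = size (X1 ++ Y1 ++ Z1).
  by rewrite -(eqP fr1) -(eqP fr2) (span_basis b1) (span_basis b2).
have [f] := lfun_of_free fr1 sz.
rewrite !map_cat => /eqP; rewrite eqseq_cat ?size_map //.
have szY : size Y2 = size Y1 by apply: (@addnI (size X1)); rewrite -{1}szX -!size_cat.
rewrite eqseq_cat ?size_map // => /and3P[/eqP fX /eqP fY /eqP fZ].
exists f; split; last 2 first.
- by rewrite -spU1 -spU2 limg_span fX.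
- by rewrite -spV1 -spV2 limg_span map_cat fX fY.
have imf : limg f = fullv.
  by rewrite -{1}(span_basis b1) limg_span !map_cat fX fY fZ (span_basis b2).
have /eqP := limg_ker_dim f fullv.
by rewrite imf capfv -{2}(add0n (\dim fullv)) eqn_add2r dimv_eq0.
Qed.

(** * Counting subspaces of and above a given subspace *)

Lemma dim_fullv_row (K : fieldType) (m : nat) :
  \dim {: 'rV[K]_m} = m.
Proof. by rewrite dimvf dim_matrix mul1r. Qed.

(** Taking images under an isomorphism g from F^(dim U) onto U is a
    dimension-preserving bijection onto the subspaces of U. *)
Lemma card_subspaces (F : finFieldType) (vT : vectType F) (U : {vspace vT})
    (k : nat) :
  #|[set W : {vspace vT} | (W <= U)%VS && (\dim W == k)]| =
    gauss_binom F (\dim U) k.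
Proof.
have bf := vbasisP (fullv : {vspace 'rV[F]_(\dim U)}).
have sz : size (vbasis U) = size (vbasis {: 'rV[F]_(\dim U)}).
  by rewrite !size_tuple dim_fullv_row.
have [g gE] := lfun_of_free (basis_free bf) sz.
have img : limg g = U.
  by rewrite -(span_basis bf) limg_span gE; apply: span_basis (vbasisP U).
have kg : lker g == 0%VS.
  have := limg_ker_dim g fullv; rewrite capfv img dim_fullv_row => dim_ker.
  by rewrite -dimv_eq0 -(eqn_add2r (\dim U)) dim_ker.
have injg : injective (fun W => (g @: W)%VS).
  by move=> W W' /eqP; rewrite eqEsubv !limg_ker0 // -eqEsubv => /eqP.
rewrite /gauss_binom -(card_imset _ injg); apply: eq_card => W.
apply/idP/imsetP; rewrite inE.
  case/andP=> sWU /eqP dW; exists (g @^-1: W)%VS; last by rewrite lpreimK ?img.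
  by rewrite inE -(lker0_dim _ kg) lpreimK ?img // dW.
case=> W'; rewrite inE => /eqP dW' ->.
by rewrite lker0_dim // dW' eqxx andbT -[X in (_ <= X)%VS]img limgS ?subvf.
Qed.

(** The quotient by U is realized as a surjection f with kernel U, which kills
    a basis of U and maps a basis of a complement to a basis; then images and
    preimages under f give the correspondence theorem. *)
Lemma card_superspaces (F : finFieldType) (vT : vectType F) (U : {vspace vT})
    (k : nat) :
  (\dim U <= k)%N ->
  #|[set W : {vspace vT} | (U <= W)%VS && (\dim W == k)]| =
    gauss_binom F (dim vT - \dim U) (k - \dim U).
Proof.
move=> leUk; set m := (dim vT - \dim U)%N.
have bV := basis_compl U.
pose T : seq 'rV[F]_m := vbasis (fullv : {vspace 'rV[F]_m}).
have szT : size T = size (vbasis U^C%VS).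
  by rewrite !size_tuple dim_fullv_row dimv_compl dimvf.
have sz : size (nseq (\dim U) 0 ++ T) = size (vbasis U ++ vbasis U^C%VS).
  by rewrite !size_cat szT size_nseq !size_tuple.
have [f] := lfun_of_free (basis_free bV) sz.
rewrite map_cat => /eqP; rewrite eqseq_cat ?size_map ?size_nseq ?size_tuple //.
case/andP=> /eqP fU /eqP fC.
have imf : limg f = fullv.
  apply/eqP; rewrite eqEsubv subvf /=.
  rewrite -[X in (X <= _)%VS](span_basis (vbasisP _)) -/T -fC.
  by rewrite -limg_span limgS ?subvf.
have kf : lker f = U.
  apply/esym/eqP; rewrite eqEdim lkerE -{1}(span_basis (vbasisP U)) limg_span fU.
  rewrite -subv0; apply/andP; split.
    by apply/span_subvP=> v; rewrite mem_nseq => /andP[_ /eqP->]; rewrite mem0v.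
  rewrite -(leq_add2r (\dim (limg f))) -{1}[lker f]capfv limg_ker_dim imf.
  by rewrite dim_fullv_row subnKC // -dimvf dimvS ?subvf.
have dim_img W : (U <= W)%VS -> (\dim U + \dim (f @: W) = \dim W)%N.
  by move=> sUW; rewrite -(limg_ker_dim f W) kf (capv_idPr sUW).
have sU_preim W : (U <= f @^-1: W)%VS by rewrite -kf -lpreim0 lpreimS ?sub0v.
have imgK W : (U <= W)%VS -> (f @^-1: (f @: W))%VS = W.
  move=> sUW; apply/esym/eqP; rewrite eqEdim -(dim_img _ sUW) -dim_img //.
  rewrite lpreimK ?imf ?subvf // leqnn andbT.
  by apply/subvP=> w Ww; rewrite -memv_preim memv_img.
have inj : {in [set W : {vspace vT} | (U <= W)%VS && (\dim W == k)] &,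
    injective (fun W => (f @: W)%VS)}.
  move=> W W'; rewrite !inE => /andP[sW _] /andP[sW' _] eqf.
  by rewrite -(imgK _ sW) eqf imgK.
rewrite /gauss_binom -(card_in_imset inj); apply: eq_card => W.
apply/imsetP/idP; rewrite inE.
  case=> W'; rewrite inE => /andP[sW' /eqP dW'] ->.
  by rewrite -(eqn_add2l (\dim U)) dim_img // dW' subnKC.
move=> /eqP dW; exists (f @^-1: W)%VS; last by rewrite lpreimK ?imf ?subvf.
by rewrite inE sU_preim -dim_img // lpreimK ?imf ?subvf // dW subnKC /=.
Qed.

(** * Vertices, flags and incidence *)

Lemma nontrivialE (F : finFieldType) (n : nat) (U : {vspace 'rV[F]_n}) :
  nontrivial U = (0 < \dim U < n)%N.
Proof.
have leUn : (\dim U <= n)%N by rewrite -[leqRHS](dim_fullv_row F) dimvS ?subvf.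
rewrite /nontrivial lt0n dimv_eq0 [U == fullv]eqEdim subvf dim_fullv_row /=.
by rewrite -ltnNge.
Qed.

Lemma vertex_dim (F : finFieldType) (n : nat) (U : vertex F n) :
  (0 < \dim (val U) < n)%N.
Proof. by rewrite -nontrivialE; apply: valP U. Qed.

Lemma psubv_dim (F : finFieldType) (vT : vectType F) (U V : {vspace vT}) :
  psubv U V = (U <= V)%VS && (\dim U < \dim V)%N.
Proof.
rewrite /psubv; case: (boolP (U <= V)%VS) => //= sUV.
by rewrite eqEdim sUV -ltnNge.
Qed.

Lemma psubv_irr (F : finFieldType) (vT : vectType F) :
  irreflexive (@psubv F vT).
Proof. by move=> U; rewrite /psubv eqxx andbF. Qed.

Lemma psubv_trans (F : finFieldType) (vT : vectType F) :
  transitive (@psubv F vT).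
Proof.
move=> V U W; rewrite !psubv_dim => /andP[sUV dUV] /andP[sVW dVW].
by rewrite (subv_trans sUV sVW) (ltn_trans dUV dVW).
Qed.

Lemma psubv_asym (F : finFieldType) (vT : vectType F) (U V : {vspace vT}) :
  psubv U V -> psubv V U = false.
Proof.
move=> ltUV; apply/negP => ltVU.
by have := psubv_trans ltUV ltVU; rewrite psubv_irr.
Qed.

Definition incident (F : finFieldType) (n : nat) : rel (vertex F n) :=
  fun U V => psubv (val U) (val V) || psubv (val V) (val U).

Lemma flag_uniq (F : finFieldType) (n : nat) (c : seq (vertex F n)) :
  flag c -> uniq c.
Proof.
apply: sorted_uniq => [V U W|U]; [exact: psubv_trans | exact: psubv_irr].
Qed.

Lemma simplexP (F : finFieldType) (n : nat) (s : {set vertex F n}) :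
  reflect (exists2 c, flag c & s = [set U in c]) (simplex s).
Proof.
apply: (iffP existsP) => [[c /andP[fc /eqP sE]]|[c fc sE]]; first by exists c.
have szc : size c == #|s|.
  by rewrite sE cardsE; apply/eqP/esym/card_uniqP/flag_uniq.
by exists (Tuple szc); rewrite /= fc {1}sE eqxx.
Qed.

Lemma simplex_incident (F : finFieldType) (n : nat) (s : {set vertex F n}) :
  simplex s -> {in s &, forall U V, U != V -> incident U V}.
Proof.
case/simplexP=> c; rewrite /flag sorted_pairwise; last first.
  by move=> V U W; apply: psubv_trans.
move=> fc -> {s} U V; rewrite !inE.
elim: c fc => //= W c IHc /andP[/allP W_lt /IHc{}IHc]; rewrite !inE.
case/predU1P=> [->|cU]; case/predU1P=> [->|cV]; first by rewrite eqxx.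
- by move=> _; rewrite /incident W_lt.
- by move=> _; rewrite /incident orbC W_lt.
- exact: IHc.
Qed.

Lemma incident_dim (F : finFieldType) (n : nat) (U V : vertex F n) :
  incident U V -> \dim (val U) != \dim (val V).
Proof.
rewrite /incident !psubv_dim neq_ltn.
by case/orP=> /andP[_ ->]; rewrite ?orbT.
Qed.

Lemma simplex_dim_inj (F : finFieldType) (n : nat) (s : {set vertex F n}) :
  simplex s -> {in s &, injective (fun U => \dim (val U))}.
Proof.
move=> simp U V sU sV eq_dim; apply/eqP; apply/negPn/negP => neqUV.
have := incident_dim (simplex_incident simp sU sV neqUV).
by rewrite eq_dim eqxx.
Qed.

(** * Complete flags *)

Lemma mem_iota1_pred (n d : nat) : (d \in iota 1 n.-1) = (0 < d < n)%N.
Proof. by rewrite mem_iota; case: n => [|n] //; case: d. Qed.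

(** The n - 1 members have distinct dimensions among the n - 1 values
    1, ..., n - 1, so every value is taken. *)
Lemma complete_flag_dim (F : finFieldType) (n : nat) (t : {set vertex F n})
    (k : nat) :
  complete_flag t -> (0 < k < n)%N -> exists2 V, V \in t & \dim (val V) = k.
Proof.
case/andP=> simp /eqP card_t k_bnd.
pose ds := [seq \dim (val V) | V <- enum t].
have uds : uniq ds.
  rewrite map_inj_in_uniq ?enum_uniq // => U V; rewrite !mem_enum.
  exact: (simplex_dim_inj simp).
have sub : {subset ds <= iota 1 n.-1}.
  by move=> d /mapP[V _ ->]; rewrite mem_iota1_pred vertex_dim.
have le_sz : (size (iota 1 n.-1) <= size ds)%N.
  by rewrite size_iota size_map -cardE card_t.
have [_ ds_eq] := uniq_min_size uds sub le_sz.
have : k \in ds by rewrite ds_eq mem_iota1_pred.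
by case/mapP=> V; rewrite mem_enum => tV ->; exists V.
Qed.

(** Double counting of the pairs (t, V) with t a complete flag through U and V
    a member of t satisfying P. *)
Lemma sum_weight_pairs (F : finFieldType) (n : nat) (U : vertex F n)
    (P : pred (vertex F n)) :
  (\sum_(V : vertex F n | P V) weight [set U; V])%N =
  (\sum_(t : {set vertex F n} | complete_flag t && (U \in t))
     #|[set V in t | P V]|)%N.
Proof.
under eq_bigr do rewrite /weight -sum1dep_card.
rewrite (exchange_big_dep (fun t => complete_flag t && (U \in t))) /=; last first.
  by move=> V t _; rewrite subUset !sub1set => /andP[-> /andP[->]].
apply: eq_bigr => t /andP[ct Ut]; rewrite -sum1dep_card; apply: eq_bigl => V.
by rewrite subUset !sub1set ct Ut andbC.
Qed.

Lemma sum_weight_dim (F : finFieldType) (n : nat) (U : vertex F n) (k : nat) :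
  (0 < k < n)%N ->
  (\sum_(V : vertex F n | \dim (val V) == k) weight [set U; V])%N =
    weight [set U].
Proof.
move=> k_bnd; rewrite sum_weight_pairs /weight -sum1dep_card.
under [RHS]eq_bigl do rewrite sub1set.
apply: eq_bigr => t /andP[ct _].
have [V tV dV] := complete_flag_dim ct k_bnd.
apply/eqP/cards1P; exists V; apply/setP => W; rewrite !inE.
apply/andP/eqP => [[tW /eqP dW]|->]; last by rewrite tV dV.
by case/andP: ct => simp _; apply: (simplex_dim_inj simp); rewrite ?dV.
Qed.

Lemma sum_weight_neq (F : finFieldType) (n : nat) (U : vertex F n) :
  (\sum_(V : vertex F n | V != U) weight [set U; V])%N =
    ((n - 2) * weight [set U])%N.
Proof.
rewrite sum_weight_pairs /weight -sum1dep_card big_distrr /=.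
under [RHS]eq_bigl do rewrite sub1set.
apply: eq_bigr => t /andP[/andP[_ /eqP card_t] Ut].
have -> : [set V in t | V != U] = t :\ U by apply/setP=> V; rewrite !inE andbC.
by rewrite cardsDS ?sub1set // cards1 card_t muln1 -subn1 -subnDA.
Qed.

Lemma weight_pair0 (F : finFieldType) (n : nat) (U V : vertex F n) :
  U != V -> ~~ incident U V -> weight [set U; V] = 0%N.
Proof.
move=> neqUV; apply: contraNeq; rewrite -lt0n => /card_gt0P[t].
rewrite inE subUset !sub1set => /andP[/andP[simp _] /andP[tU tV]].
exact: (simplex_incident simp).
Qed.

(** * Action of linear automorphisms on flags *)

(** The default value U of [insubd] is only reached when f is not injective on
    U. *)
Definition vmap (F : finFieldType) (n : nat) (f : 'End('rV[F]_n))
  (U : vertex F n) : vertex F n := insubd U (f @: val U)%VS.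

Lemma val_vmap (F : finFieldType) (n : nat) (f : 'End('rV[F]_n))
    (U : vertex F n) : lker f == 0%VS -> val (vmap f U) = (f @: val U)%VS.
Proof.
move=> kf; rewrite val_insubd -[X in if X then _ else _]/(nontrivial _).
by rewrite nontrivialE lker0_dim // vertex_dim.
Qed.

Lemma vmap_inj (F : finFieldType) (n : nat) (f : 'End('rV[F]_n)) :
  lker f == 0%VS -> injective (@vmap F n f).
Proof.
move=> kf U V /(congr1 val); rewrite !val_vmap // => /eqP.
by rewrite eqEsubv !limg_ker0 // -eqEsubv => /eqP/val_inj.
Qed.

Lemma vmap_psubv (F : finFieldType) (n : nat) (f : 'End('rV[F]_n))
    (U V : vertex F n) : lker f == 0%VS ->
  psubv (val (vmap f U)) (val (vmap f V)) = psubv (val U) (val V).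
Proof. by move=> kf; rewrite !psubv_dim !val_vmap // limg_ker0 // !lker0_dim. Qed.

Lemma vmap_complete_flag (F : finFieldType) (n : nat) (f : 'End('rV[F]_n))
    (t : {set vertex F n}) :
  lker f == 0%VS -> complete_flag t -> complete_flag (vmap f @: t).
Proof.
move=> kf /andP[/simplexP[c fc tE] card_t].
rewrite /complete_flag (card_imset _ (vmap_inj kf)) card_t andbT.
apply/simplexP; exists (map (vmap f) c).
  rewrite /flag sorted_map; apply: sub_sorted fc => U V.
  by rewrite /relpre /= vmap_psubv.
apply/setP=> V; rewrite tE inE.
apply/imsetP/mapP => [] [U]; rewrite ?inE => cU ->; exists U => //.
by rewrite inE.
Qed.

Lemma weight_vmap (F : finFieldType) (n : nat) (f : 'End('rV[F]_n))
    (s : {set vertex F n}) :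
  lker f == 0%VS -> (weight s <= weight (vmap f @: s))%N.
Proof.
move=> kf; rewrite /weight -(card_imset _ (imset_inj (vmap_inj kf))).
apply: subset_leq_card; apply/subsetP => _ /imsetP[t + ->].
rewrite !inE => /andP[ct sst].
by rewrite vmap_complete_flag // imsetS.
Qed.

Lemma weight_pair_dim (F : finFieldType) (n : nat) (U V U' V' : vertex F n) :
  (val U <= val V)%VS -> (val U' <= val V')%VS ->
  \dim (val U) = \dim (val U') -> \dim (val V) = \dim (val V') ->
  weight [set U; V] = weight [set U'; V'].
Proof.
wlog suff le_w : U V U' V' / (val U <= val V)%VS -> (val U' <= val V')%VS ->
    \dim (val U) = \dim (val U') -> \dim (val V) = \dim (val V') ->
    (weight [set U; V] <= weight [set U'; V'])%N.
  by move=> *; apply/eqP; rewrite eqn_leq !le_w.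
move=> sUV sUV' dU dV.
have [f [kf fU fV]] := aut_of_flag sUV sUV' dU dV.
have -> : U' = vmap f U by apply: val_inj; rewrite val_vmap // fU.
have -> : V' = vmap f V by apply: val_inj; rewrite val_vmap // fV.
by rewrite -imset_set1 -[[set vmap f V]]imset_set1 -imsetU weight_vmap.
Qed.

(** * Weight ratios as Gaussian binomials *)

Lemma card_vertex (F : finFieldType) (n k : nat) (P : pred {vspace 'rV[F]_n}) :
  (0 < k < n)%N ->
  #|[set V : vertex F n | P (val V) && (\dim (val V) == k)]| =
    #|[set W : {vspace 'rV[F]_n} | P W && (\dim W == k)]|.
Proof.
move=> k_bnd; rewrite -(card_imset _ val_inj); apply: eq_card => W.
apply/imsetP/idP; rewrite inE; first by case=> V; rewrite inE => ? ->.
case/andP=> PW /eqP dW; have ntW : nontrivial W by rewrite nontrivialE dW.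
by exists (Sub W ntW); rewrite ?inE SubK ?PW ?dW /=.
Qed.

(** In the sum of w({U, W}) over the W with dim W = dim V, the terms with W not
    above U vanish and the others all equal w({U, V}). *)
Lemma weight_above (F : finFieldType) (n : nat) (U V : vertex F n) :
  psubv (val U) (val V) ->
  weight [set U] =
    (gauss_binom F (n - \dim (val U)) (\dim (val V) - \dim (val U)) *
     weight [set U; V])%N.
Proof.
move=> ltUV; move: (ltUV); rewrite psubv_dim => /andP[sUV dUV].
rewrite -(sum_weight_dim U (vertex_dim V)).
have := card_superspaces (ltnW dUV); rewrite -dimvf dim_fullv_row => <-.
rewrite -(card_vertex (fun W => (val U <= W)%VS)) ?vertex_dim //.
rewrite -sum_nat_const (bigID (fun W => (val U <= val W)%VS)) /=.
rewrite [X in (_ + X)%N]big1 ?addn0 => [|W /andP[/eqP dW nsUW]].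
  apply: eq_big => [W|W /andP[/eqP dW sUW]]; first by rewrite inE andbC.
  exact: weight_pair_dim.
apply: weight_pair0; first by apply: contraNneq nsUW => <-.
by rewrite /incident !psubv_dim (negPf nsUW) dW (leq_gtF (ltnW dUV)) andbF.
Qed.

Lemma weight_below (F : finFieldType) (n : nat) (U V : vertex F n) :
  psubv (val V) (val U) ->
  weight [set U] =
    (gauss_binom F (\dim (val U)) (\dim (val V)) * weight [set U; V])%N.
Proof.
move=> ltVU; move: (ltVU); rewrite psubv_dim => /andP[sVU dVU].
rewrite -(sum_weight_dim U (vertex_dim V)) -card_subspaces.
rewrite -(card_vertex (fun W => (W <= val U)%VS)) ?vertex_dim //.
rewrite -sum_nat_const (bigID (fun W => (val W <= val U)%VS)) /=.
rewrite [X in (_ + X)%N]big1 ?addn0 => [|W /andP[/eqP dW nsWU]].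
  apply: eq_big => [W|W /andP[/eqP dW sWU]]; first by rewrite inE andbC.
  by rewrite ![[set U; _]]setUC; apply: weight_pair_dim.
apply: weight_pair0; first by apply: contraNneq nsWU => <-.
by rewrite /incident !psubv_dim (negPf nsWU) dW (leq_gtF (ltnW dVU)) andbF.
Qed.

(** Spans of the prefixes of a basis of F^n that starts with a basis of U form a
    complete flag, with U at position dim U. *)
Lemma weight_gt0 (F : finFieldType) (n : nat) (U : vertex F n) :
  (0 < weight [set U])%N.
Proof.
pose b := vbasis (val U) ++ vbasis (val U)^C%VS.
have bb : basis_of fullv b := basis_compl (val U).
have szb : size b = n.
  by rewrite -(eqP (basis_free bb)) (span_basis bb) dim_fullv_row.
have dim_take i : (i <= n)%N -> \dim <<take i b>> = i.
  move=> le_in; have: free (take i b).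
    by apply: (@catl_free _ _ (drop i b)); rewrite cat_take_drop (basis_free bb).
  by move/eqP->; rewrite size_takel ?szb.
pose S i : vertex F n := insubd U <<take i b>>%VS.
have valS i : (0 < i < n)%N -> val (S i) = <<take i b>>%VS.
  move=> /andP[i_gt0 i_ltn]; rewrite val_insubd.
  rewrite -[X in if X then _ else _]/(nontrivial _) nontrivialE.
  by rewrite dim_take ?i_gt0 ?i_ltn // ltnW.
pose c := [seq S i | i <- iota 1 n.-1].
have fc : flag c.
  rewrite /flag sorted_map.
  apply: (@sub_in_sorted _ (mem (iota 1 n.-1)) ltn); last exact: iota_ltn_sorted.
    move=> i j; rewrite !mem_iota1_pred => bi bj ltij.
    rewrite /relpre /= psubv_dim !valS //.
    case/andP: bi => _ /ltnW ?; case/andP: bj => _ /ltnW ?.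
    rewrite !dim_take // (ltij : (i < j)%N) andbT.
    have -> : take j b = take i b ++ drop i (take j b).
      by rewrite -{1}(cat_take_drop i (take j b)) take_takel ?(ltnW ltij).
    by rewrite span_cat; apply: addvSl.
  by apply/allP.
apply/card_gt0P; exists [set V in c]; rewrite inE /complete_flag sub1set inE.
rewrite cardsE (card_uniqP (flag_uniq fc)) size_map size_iota eqxx andbT.
apply/andP; split; first by apply/simplexP; exists c.
apply/mapP; exists (\dim (val U)); first by rewrite mem_iota1_pred vertex_dim.
apply: val_inj; rewrite valS ?vertex_dim //.
rewrite take_size_cat ?size_tuple //.
by rewrite (span_basis (vbasisP _)).
Qed.

(** * The up-Laplacian as a weighted graph Laplacian *)

Lemma flag_pair_is_edge (F : finFieldType) (n : nat) (U V : vertex F n) :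
  psubv (val U) (val V) -> is_edge (U, V).
Proof.
move=> ltUV; apply/andP; split=> /=.
  by apply: contraTneq ltUV => ->; rewrite psubv_irr.
apply/simplexP; exists [:: U; V]; first by rewrite /flag /= ltUV.
by apply/setP=> W; rewrite !inE.
Qed.

Lemma sum_edge (R : realType) (F : finFieldType) (n : nat)
    (f : vertex F n -> vertex F n -> R) :
  \sum_(e : edge F n | psubv (val (source e)) (val (target e)))
     f (source e) (target e) =
  \sum_(U : vertex F n) \sum_(V : vertex F n | psubv (val U) (val V)) f U V.
Proof.
rewrite pair_big_dep /=.
rewrite [RHS](reindex_omap (val : edge F n -> _) insub) => [|[U V] /= ltUV].
  by apply: eq_bigl => e; rewrite valK eqxx andbT.
by rewrite insubT ?flag_pair_is_edge.
Qed.

Lemma incident_down (F : finFieldType) (n : nat) (U V : vertex F n) :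
  incident U V && psubv (val V) (val U) = psubv (val V) (val U).
Proof.
by rewrite andbC; apply: andb_idr => ltVU; rewrite /incident ltVU orbT.
Qed.

Lemma incident_up (F : finFieldType) (n : nat) (U V : vertex F n) :
  incident U V && ~~ psubv (val V) (val U) = psubv (val U) (val V).
Proof.
rewrite /incident; have [ltUV|_] := boolP (psubv (val U) (val V)).
  by rewrite (psubv_asym ltUV).
by case: (psubv _ _).
Qed.

(** An edge contributes only if U is one of its ends: the edges ending at U come
    from the V below U, those starting at U from the V above, and both give
    psi(U) - psi(V) after the signs of the two coboundaries cancel. *)
Lemma ip1_d0_indic (R : realType) (F : finFieldType) (n : nat) (U : vertex F n)
    (psi : C0 R F n) :
  ip1 (d0 (indic R U)) (d0 psi) =
  \sum_(V : vertex F n | incident U V)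
    (weight [set U; V])%:R * (psi U - psi V).
Proof.
pose w (A B : vertex F n) : R := (weight [set A; B])%:R.
have -> : ip1 (d0 (indic R U)) (d0 psi) =
    \sum_A \sum_(B | psubv (val A) (val B))
      ((B == U)%:R * (w A B * (psi B - psi A)) +
       (A == U)%:R * (w A B * (psi A - psi B))).
  rewrite -(sum_edge (fun A B => (B == U)%:R * (w A B * (psi B - psi A)) +
       (A == U)%:R * (w A B * (psi A - psi B)))).
  apply: eq_bigr => e _; rewrite !ffunE -/(w _ _).
  have expand (a b c x y : R) :
      c * (a - b) * (y - x) = a * (c * (y - x)) + b * (c * (x - y)).
    by rewrite -(opprB y x) !mulrN -mulrBl mulrA [c * _]mulrC.
  exact: expand.
under eq_bigr do rewrite big_split /=.
rewrite big_split /= [RHS](bigID (fun V => psubv (val V) (val U))) /=.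
(* The first sum collects the edges ending at U, the second those starting there. *)
congr (_ + _).
  under [RHS]eq_bigl do rewrite incident_down.
  rewrite [RHS]big_mkcond; apply: eq_bigr => A _ /=.
  rewrite big_mkcond (bigD1 U) //= big1 ?addr0 => [|B /negPf->].
    by rewrite eqxx mul1r /w setUC.
  by rewrite mul0r if_same.
under [RHS]eq_bigl do rewrite incident_up.
rewrite (bigD1 U) //= [X in _ + X]big1 ?addr0 => [|A /negPf neq].
  by apply: eq_bigr => V _; rewrite eqxx mul1r.
by rewrite big1 // => B _; rewrite neq mul0r.
Qed.

Lemma ip0_indic (R : realType) (F : finFieldType) (n : nat) (U : vertex F n)
    (psi : C0 R F n) :
  ip0 (indic R U) psi = (weight [set U])%:R * psi U.
Proof.
rewrite /ip0 (bigD1 U) //= big1 ?addr0 => [|V /negPf neq].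
  by rewrite ffunE eqxx mulr1.
by rewrite ffunE neq mulr0 mul0r.
Qed.

(** Pairing with 1_U forces (g psi)(U) = w(U)^-1 <d 1_U, psi>; this formula works
    for every phi because phi is a combination of the 1_U. *)
Lemma d0_adj_exists (R : realType) (F : finFieldType) (n : nat) :
  exists g, is_adjoint (@d0 R F n) g.
Proof.
exists (fun psi =>
  [ffun U => (weight [set U])%:R^-1 * ip1 (d0 (indic R U)) psi]).
move=> phi psi.
transitivity (\sum_U phi U * ip1 (d0 (indic R U)) psi).
  under [RHS]eq_bigr do rewrite big_distrr /=.
  rewrite exchange_big /=; apply: eq_bigr => e _.
  under eq_bigr do rewrite !ffunE mulrA mulrCA.
  rewrite -big_distrl /= -big_distrr /= !ffunE.
  have phiE W : phi W = \sum_U phi U * (W == U)%:R.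
    rewrite (bigD1 W) //= eqxx mulr1 big1 ?addr0 // => U.
    by rewrite eq_sym => /negPf->; rewrite mulr0.
  rewrite (phiE (target e)) (phiE (source e)) -sumrB.
  by under [in RHS]eq_bigr do rewrite mulrBr.
apply: eq_bigr => U _; rewrite !ffunE [_ * phi U]mulrC -mulrA mulVKf //.
by rewrite pnatr_eq0 -lt0n weight_gt0.
Qed.

Lemma laplacianE (R : realType) (F : finFieldType) (n : nat) (phi : C0 R F n)
    (U : vertex F n) :
  laplacian phi U =
  (weight [set U])%:R^-1 *
  \sum_(V : vertex F n | incident U V)
    (weight [set U; V])%:R * (phi U - phi V).
Proof.
have adj : is_adjoint (@d0 R F n) (@d0_adj R F n).
  rewrite /d0_adj; case: classical_sets.xgetP => [g _ //|no_adj].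
  by have [g /no_adj] := d0_adj_exists R F n.
rewrite -ip1_d0_indic adj ip0_indic mulKf //.
by rewrite pnatr_eq0 -lt0n weight_gt0.
Qed.

Lemma laplacian_indic_neq (R : realType) (F : finFieldType) (n : nat)
    (U V : vertex F n) : U != V ->
  laplacian (indic R V) U =
  if incident U V then - ((weight [set U; V])%:R / (weight [set U])%:R) else 0.
Proof.
move=> neqUV; rewrite laplacianE big_mkcond (bigD1 V) //= big1 => [|W neqWV].
  case: ifP => _; rewrite addr0 ?mulr0 // !ffunE eqxx (negPf neqUV) sub0r.
  by rewrite !mulrN mulr1 mulrC.
by rewrite !ffunE (negPf neqUV) (negPf neqWV) subrr mulr0 if_same.
Qed.

Lemma laplacian_indic_diag (R : realType) (F : finFieldType) (n : nat)
    (U : vertex F n) : laplacian (indic R U) U = (n - 2)%:R.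
Proof.
have w_neq0 : (weight [set U])%:R != 0 :> R.
  by rewrite pnatr_eq0 -lt0n weight_gt0.
apply: (mulfI w_neq0); rewrite laplacianE mulVKf // mulrC -natrM -sum_weight_neq.
rewrite natr_sum [RHS](bigID (incident U)) /=.
rewrite [X in _ = _ + X]big1 ?addr0 => [|V /andP[neq ncmp]]; last first.
  by rewrite weight_pair0 // eq_sym.
have cmp_neq V : incident U V -> V != U.
  by move/incident_dim; apply: contraNneq => ->.
apply: eq_big => [V|V /cmp_neq/negPf neq].
  by case: (boolP (incident U V)) => [/cmp_neq->|]; rewrite ?andbF.
by rewrite !ffunE eqxx neq subr0 mulr1.
Qed.

Theorem corollary1p2 (R : realType) (n q : nat) (F : finFieldType)
    (hn : (3 <= n)%N) (hq : prime_power q) (hF : #|F| = q)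
    (U V : vertex F n) :
  laplacian_mx R F n (enum_rank U) (enum_rank V) =
    if U == V then (n - 2)%:R
    else if psubv (val U) (val V) then
      - ((gauss_binom F (n - \dim (val U)) (\dim (val V) - \dim (val U)))%:R)^-1
    else if psubv (val V) (val U) then
      - ((gauss_binom F (\dim (val U)) (\dim (val V)))%:R)^-1
    else 0.
Proof.
rewrite mxE !enum_rankK.
case: eqVneq => [->|neqUV]; first exact: laplacian_indic_diag.
have ratio k : weight [set U] = (k * weight [set U; V])%N ->
    (weight [set U; V])%:R / (weight [set U])%:R = k%:R^-1 :> R.
  move=> wE; have := weight_gt0 U; rewrite wE muln_gt0 => /andP[_ w_gt0].
  by rewrite natrM invfM mulrCA mulfV ?mulr1 // pnatr_eq0 -lt0n.
rewrite laplacian_indic_neq // /incident.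
have [ltUV|_] /= := boolP (psubv (val U) (val V)).
  by rewrite (ratio _ (weight_above ltUV)).
have [ltVU|//] := boolP (psubv (val V) (val U)).
by rewrite (ratio _ (weight_below ltVU)).
Qed.
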